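(* Let $\mathcal{P}$ be the set of all continuous surjective mappings $I\to I^2$, regarded as a subset of the semigroup $C(I,I^2)$ of all continuous mappings $I\to I^2$ under coordinatewise multiplication. Then $\mathcal{P}$ is semigroupable; that is, there exists an infinitely generated semigroup $G\subset\mathcal{P}$.
   Context: $I=[0,1]$, $I^2=[0,1]\times[0,1]$. Coordinatewise multiplication on $C(I,I^2)$: if $f=(f_1,f_2)$ and $g=(g_1,g_2)$ then $fg=(f_1g_1,f_2g_2)$ (pointwise products); this is a commutative semigroup operation. If $(X,* )$ is a semigroup and $A\subset X$, then $A$ is called semigroupable if there exists an infinitely generated (sub)semigroup $G\subset A$ of $X$. A semigroup $G$ is infinitely generated if it is not finitely generated, i.e. no finite set generates it, meaning that there is no finite set of elements of $G$ such that every element of $G$ is a finite product of positive powers of elements of that set. *)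

(* Defs.v *)
From HB Require Import structures.
From mathcomp Require Import all_boot all_order all_algebra.
From mathcomp Require Import all_classical all_reals all_analysis.
Set Implicit Arguments.
Unset Strict Implicit.
Unset Printing Implicit Defensive.
Import Order.TTheory GRing.Theory Num.Theory.
Import numFieldNormedType.Exports.
Local Open Scope classical_set_scope.
Local Open Scope ring_scope.

Section semigroupable.
Context {S : semigroupType}.
Implicit Types (A B G : set S).

(* A semigroup has no unit, hence powers are only meaningful for [0 < n] and
   products for nonempty families. *)
Definition spow (x : S) (n : nat) : S := iterop n *%g x x.

Definition sprod (x : S) (s : seq S) : S := foldl *%g x s.

(* Nonempty finite products of positive powers of elements of [B]; the pair
   [(b, n)] stands for the factor [b ^ n]. *)
Definition power_products B : set S :=
  [set x | exists (p : S * nat) (s : seq (S * nat)),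
     {in p :: s, forall q, B q.1 /\ (0 < q.2)%N} /\
     x = sprod (spow p.1 p.2) [seq spow q.1 q.2 | q <- s]].

Definition finitely_generated G : Prop :=
  exists B, [/\ finite_set B, B `<=` G & G `<=` power_products B].

Definition infinitely_generated G : Prop := ~ finitely_generated G.

Definition semigroupable A : Prop :=
  exists G, [/\ G `<=` A, mulg_closed (mem G) & infinitely_generated G].

End semigroupable.

Section curves.
Context {R : realType}.

(* Used as a type, [I01] carries the subspace topology and [I01 * I01] the
   product topology. *)
Definition I01 : set R := `[0, 1].

Lemma I01_mulP (x y : I01) : I01 (set_val x * set_val y).
Proof.
have := set_valP x; have := set_valP y.
rewrite /I01 /= !in_itv /= => /andP[y0 y1] /andP[x0 x1].
by rewrite mulr_ge0 //= mulr_ile1.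
Qed.

Definition mulI (x y : I01) : I01 := SigSub (mem_set (I01_mulP x y)).

Lemma val_mulI (x y : I01) : set_val (mulI x y) = set_val x * set_val y.
Proof. by []. Qed.

Lemma mulIA : associative mulI.
Proof. by move=> x y z; apply/val_inj => /=; rewrite mulrA. Qed.

Lemma mulIC : commutative mulI.
Proof. by move=> x y; apply/val_inj => /=; rewrite mulrC. Qed.

Lemma continuous_mulI (T : topologicalType) (f g : T -> I01) :
  continuous f -> continuous g -> continuous (fun t => mulI (f t) (g t)).
Proof.
move=> cf cg; apply: continuous_comp_initial => t.
have cv (h : T -> I01) : continuous h -> set_val (h x) @[x --> t] --> set_val (h t).
  by move=> ch; apply: (continuous_comp (ch t)); exact: initial_continuous.
exact: cvgM (cv _ cf) (cv _ cg).
Qed.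

(* The set C(I, I^2) of all continuous maps, not only the surjective ones. *)
Definition curve := continuousType I01 (I01 * I01)%type.

HB.instance Definition _ := Choice.on curve.

Definition curve_mul_fun (f g : curve) (t : I01) : I01 * I01 :=
  (mulI (f t).1 (g t).1, mulI (f t).2 (g t).2).

Lemma continuous_curve_mul (f g : curve) : continuous (curve_mul_fun f g).
Proof.
have c1 (h : curve) : continuous (fun t => (h t).1).
  by move=> t; apply: (continuous_comp (cts_fun t)); exact: cvg_fst.
have c2 (h : curve) : continuous (fun t => (h t).2).
  by move=> t; apply: (continuous_comp (cts_fun t)); exact: cvg_snd.
move=> t.
exact: (cvg_pair (continuous_mulI (c1 f) (c1 g) (x := t))
                 (continuous_mulI (c2 f) (c2 g) (x := t))).
Qed.

Definition curve_mul (f g : curve) : curve := mkcts (@continuous_curve_mul f g).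

Lemma curve_mulE (f g : curve) t :
  curve_mul f g t = (mulI (f t).1 (g t).1, mulI (f t).2 (g t).2).
Proof. by []. Qed.

Lemma curve_mulA : associative curve_mul.
Proof.
by move=> f g h; apply/continuousEP => t; rewrite !curve_mulE /= !mulIA.
Qed.

Lemma curve_mulC : commutative curve_mul.
Proof.
by move=> f g; apply/continuousEP => t; rewrite !curve_mulE mulIC (mulIC (f t).2).
Qed.

HB.instance Definition _ := isSemigroup.Build curve curve_mulA.

Definition surjective_curves : set curve :=
  [set f | range (f : I01 -> I01 * I01) = [set: I01 * I01]].

End curves.

Arguments I01 : clear implicits.
Arguments curve : clear implicits.
Arguments surjective_curves : clear implicits.

(* Main.v *)
(* A variant of Schoenberg's space-filling curve is (X, Y), where X reads the
   even ternary digits of a point of the Cantor set and Y the odd ones, both as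
   binary digits.  As powers map I onto I, every (X^i, Y^j) with i, j > 0 is again
   surjective, and these curves form a semigroup isomorphic to that of pairs of
   positive integers under addition.  Each (X, Y^j) is irreducible there, hence
   belongs to every generating set, and there are infinitely many of them. *)
Require Import Defs.
From mathcomp Require Import all_boot all_order all_algebra.
From mathcomp Require Import all_classical all_reals all_analysis.
From mathcomp Require Import lra ring.
Set Implicit Arguments.
Unset Strict Implicit.
Unset Printing Implicit Defensive.
Import Order.TTheory GRing.Theory Num.Theory.
Import numFieldNormedType.Exports.
Local Open Scope classical_set_scope.
Local Open Scope ring_scope.

(** * Irreducible elements and generating sets of a semigroup *)

Section irreducible_elements.
Context {S : semigroupType}.
Implicit Types (A B G : set S).

Definition irreducible_in G (x : S) :=
  forall y z, G y -> G z -> x <> (y * z)%g.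

Lemma mulg_closed_memP G :
  mulg_closed (mem G) <-> forall x y, G x -> G y -> G (x * y)%g.
Proof.
split=> GM x y; last by rewrite !inE; exact: GM.
by move=> Gx Gy; apply/set_mem/GM; exact: mem_set.
Qed.

Lemma spowS (x : S) n : spow x n.+2 = (x * spow x n.+1)%g.
Proof. by []. Qed.

Lemma spow_closed G x n : mulg_closed (mem G) -> G x -> G (spow x n.+1).
Proof.
by move=> /mulg_closed_memP GM Gx; elim: n => [//|n IHn]; rewrite spowS; exact: GM.
Qed.

Lemma sprod_closed G x s :
  mulg_closed (mem G) -> G x -> {in s, forall y, G y} -> G (sprod x s).
Proof.
move=> GM; elim: s x => [//|y s IHs] x Gx Gs; apply: IHs.
  by apply: (mulg_closed_memP G).1 => //; apply: Gs; rewrite mem_head.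
by move=> z zs; apply: Gs; rewrite inE zs orbT.
Qed.

(** Any longer product splits into two elements of [G], and so does a single power [b ^ n] with
    [n > 1]; only the factor [b ^ 1] is left. *)
Lemma irreducible_generator G B x : mulg_closed (mem G) -> B `<=` G ->
  irreducible_in G x -> power_products B x -> B x.
Proof.
move=> GM BG irrx [[b n] [s [Bs xE]]].
have Gs q : q \in (b, n) :: s -> G (spow q.1 q.2).
  move=> /Bs[Bq]; case: q.2 => // m _.
  by apply: spow_closed => //; exact: BG.
have [Bb n_gt0] : B b /\ (0 < n)%N by exact: (Bs _ (mem_head _ _)).
(* [sprod] is a left fold, so the factor to split off is the last one. *)
case/lastP: s xE {Bs} Gs => [|s q] /= -> Gs in irrx *.
  case: n n_gt0 => [//|[//|n] _] in irrx Gs *.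
  case: (irrx b (spow b n.+1)) => //; first exact: BG.
  by apply: spow_closed => //; exact: BG.
case: (irrx (sprod (spow b n) [seq spow r.1 r.2 | r <- s]) (spow q.1 q.2)).
- apply: sprod_closed => //; first exact: (Gs _ (mem_head _ _)).
  move=> _ /mapP[r rs ->]; apply: Gs.
  by rewrite inE mem_rcons inE rs !orbT.
- by apply: Gs; rewrite inE mem_rcons mem_head orbT.
- by rewrite map_rcons /sprod foldl_rcons.
Qed.

Lemma infinitely_generated_irreducible G (u : nat -> S) : mulg_closed (mem G) ->
  injective u -> (forall n, G (u n)) -> (forall n, irreducible_in G (u n)) ->
  infinitely_generated G.
Proof.
move=> GM u_inj Gu irru [B [finB BG GB]].
apply: infinite_nat.
have <- : u @^-1` B = setT.
  apply/seteqP; split=> // n _.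
  exact: irreducible_generator GM BG (irru n) (GB _ (Gu n)).
by apply: finite_preimage finB => m n _ _; exact: u_inj.
Qed.

End irreducible_elements.

(** * Expansions in base [q^-1] with digits in [0, 1] *)

Section expansion.
Context {R : realType}.
Implicit Types (q : R) (a x : nat -> R).

(** The factor [1 - q] gives the constant sequence 1 the sum 1. For [q = 1/2] this is a binary
    expansion, for [q = 1/3] a ternary one with digits [2 * a k]. Digits are real so that they can
    depend continuously on a parameter. *)
Definition expansion q a : R := limn (series (fun k => (1 - q) * a k * q ^+ k)).

Variable q : R.
Hypotheses (q_ge0 : 0 <= q) (q_lt1 : q < 1).

Lemma normr_ratio_lt1 : `|q| < 1.
Proof. by rewrite ger0_norm. Qed.

Lemma expansion_term_bound a : (forall k, 0 <= a k <= 1) ->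
  forall k, 0 <= (1 - q) * a k * q ^+ k <= geometric (1 - q) q k.
Proof.
move=> a01 k; have /andP[a0 a1] := a01 k.
have q1 : 0 <= 1 - q by rewrite subr_ge0 ltW.
rewrite !mulr_ge0 ?exprn_ge0 //= ler_wpM2r ?exprn_ge0 //.
by rewrite ler_piMr.
Qed.

Lemma is_cvg_expansion a : (forall k, 0 <= a k <= 1) ->
  cvgn (series (fun k => (1 - q) * a k * q ^+ k)).
Proof.
move=> a01; have ab := expansion_term_bound a01.
apply: (@series_le_cvg _ _ (geometric (1 - q) q)) => [k|k|k|].
- by have /andP[] := ab k.
- by have /andP[] := ab k; exact: le_trans.
- by have /andP[] := ab k.
- exact: is_cvg_geometric_series normr_ratio_lt1.
Qed.

Lemma expansion_bound a : (forall k, 0 <= a k <= 1) -> 0 <= expansion q a <= 1.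
Proof.
move=> a01; have ab := expansion_term_bound a01.
have cvga := is_cvg_expansion a01.
apply/andP; split.
  apply: limr_ge => //; near=> n; apply: sumr_ge0 => k _.
  by have /andP[] := ab k.
have lim1 : limn (series (geometric (1 - q) q)) = 1.
  apply: cvg_lim => //; rewrite -[X in _ --> X](@divff _ (1 - q)).
    exact: cvg_geometric_series normr_ratio_lt1.
  by rewrite subr_eq0 gt_eqF.
rewrite -[leRHS]lim1; apply: lim_series_le => //.
  exact: is_cvg_geometric_series normr_ratio_lt1.
by move=> k; have /andP[] := ab k.
Unshelve. all: by end_near.
Qed.

Lemma expansionS a : (forall k, 0 <= a k <= 1) ->
  expansion q a = (1 - q) * a 0 + q * expansion q (fun k => a k.+1).
Proof.
move=> a01; apply: cvg_lim => //; rewrite -cvg_shiftS/=.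
have -> : (fun n => series (fun k => (1 - q) * a k * q ^+ k) n.+1) =
    (fun n => (1 - q) * a 0 + q * series (fun k => (1 - q) * a k.+1 * q ^+ k) n).
  apply/funext => n; rewrite /series /= big_nat_recl // expr0 mulr1.
  congr (_ + _); rewrite mulr_sumr; apply: eq_bigr => k _.
  by rewrite exprS; ring.
apply: cvgD; first exact: cvg_cst.
by apply: cvgMr; exact: is_cvg_expansion.
Qed.

Lemma expansion_split a n : (forall k, 0 <= a k <= 1) ->
  expansion q a = \sum_(k < n) (1 - q) * a k * q ^+ k +
                  q ^+ n * expansion q (fun k => a (n + k)%N).
Proof.
move=> a01; elim: n => [|n IHn]; first by rewrite big_ord0 add0r expr0 mul1r.
rewrite {}IHn big_ord_recr /= expansionS // addn0 exprS.
rewrite (_ : (fun k => a (n + k.+1)%N) = (fun k => a (n.+1 + k)%N)); first by ring.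
by apply/funext => k; rewrite addnS.
Qed.

Lemma expr_small (e : R) : 0 < e -> exists n, q ^+ n < e.
Proof.
move=> e0; have /cvgrPdist_lt /(_ e e0) [n _ /(_ n (leqnn n))] := cvg_expr normr_ratio_lt1.
by rewrite sub0r normrN ger0_norm ?exprn_ge0 //; exists n.
Qed.

(** Unrolling the recursion [n] times gives the first [n] terms of the expansion; the two remainders
    both lie between 0 and [q ^+ n]. *)
Lemma expansion_unique a x : (forall k, 0 <= a k <= 1) ->
  (forall k, 0 <= x k <= 1) -> (forall k, x k = (1 - q) * a k + q * x k.+1) ->
  x 0 = expansion q a.
Proof.
move=> a01 x01 xS.
have x_split n : x 0 = \sum_(k < n) (1 - q) * a k * q ^+ k + q ^+ n * x n.
  elim: n => [|n ->]; first by rewrite big_ord0 add0r expr0 mul1r.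
  by rewrite big_ord_recr /= [in LHS]xS exprS; ring.
apply/eqP; rewrite -subr_eq0 -normr_le0; apply/ler_addgt0Pl => e /expr_small[n qne].
rewrite addr0 (x_split n) (expansion_split n a01) opprD addrACA subrr add0r.
rewrite -mulrBr normrM (ger0_norm (exprn_ge0 _ q_ge0)).
apply: le_trans (ltW qne); rewrite ler_piMr ?exprn_ge0 //.
have /andP[] := x01 n; have := @expansion_bound (fun k => a (n + k)%N) (fun=> a01 _).
by move=> /andP[]; rewrite ler_norml; lra.
Qed.

(** The tails are at most [q ^+ n] uniformly in [t], so this is a uniform limit of continuous finite
    sums. *)
Lemma continuous_expansion (T : topologicalType) (a : nat -> T -> R) :
  (forall k t, 0 <= a k t <= 1) -> (forall k, continuous (a k)) ->
  continuous (fun t => expansion q (a ^~ t)).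
Proof.
move=> a01 ca t; apply/cvgrPdist_le => e e0.
(* One half of [e] bounds the difference of the tails, the other that of the finite sums. *)
have [n qne] := expr_small (divr_gt0 e0 (ltr0Sn R 1)).
have cS : continuous (fun s => \sum_(k < n) (1 - q) * a k s * q ^+ k).
  elim: (n) => [|m IHm] s.
    by under eq_fun do rewrite big_ord0; exact: cvg_cst.
  under eq_fun do rewrite big_ord_recr.
  apply: cvgD; first exact: IHm.
  by apply: cvgMl; apply: cvgMr; exact: ca.
have /cvgrPdist_le /(_ _ (divr_gt0 e0 (ltr0Sn R 1))) := cS t.
apply: filterS => s; rewrite (expansion_split n (a01 ^~ t)) (expansion_split n (a01 ^~ s)).
set St := \sum_(k < n) _; set Ss := \sum_(k < n) _ => /ler_normlP[S1 S2].
have /andP[] := @expansion_bound (fun k => a (n + k)%N t) (fun=> a01 _ _).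
have /andP[] := @expansion_bound (fun k => a (n + k)%N s) (fun=> a01 _ _).
set Et := expansion _ _; set Es := expansion _ _ => Et0 Et1 Es0 Es1.
have := exprn_ge0 n q_ge0; move: qne; set p := q ^+ n => pe p0.
rewrite ler_norml; apply/andP; split; nra.
Qed.
End expansion.

(** * Schoenberg's function and its values on the Cantor set *)

Section schoenberg.
Context {R : realType}.
Implicit Types (t u v : R) (c : nat -> bool).

(* Stretches each outer third of [0, 1] onto [0, 1], so it shifts the ternary
   digits of the points of the Cantor set. *)
Definition zigzag t : R := Num.max (Num.min (3 * t) (2 - 3 * t)) (3 * t - 2).

(* On the Cantor set, half the leading ternary digit. *)
Definition threshold t : R := Num.min 1 (Num.max 0 (3 * t - 1)).

(** Only even iterates are read; [schoenberg (zigzag t)] reads the odd ones, so one function yields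
    both coordinates. *)
Definition schoenberg t : R :=
  expansion 2^-1 (fun k => threshold (iter k.*2 zigzag t)).

Lemma half_bounds : (0 <= 2^-1 :> R) /\ (2^-1 < 1 :> R).
Proof. by split; lra. Qed.

Lemma third_bounds : (0 <= 3^-1 :> R) /\ (3^-1 < 1 :> R).
Proof. by split; lra. Qed.

Lemma threshold_bound t : 0 <= threshold t <= 1.
Proof.
by rewrite /threshold le_min ge_min !le_max ler01 !lexx.
Qed.

Lemma continuous_affine (a b : R) : continuous (fun t : R => a * t + b).
Proof.
by move=> t; apply: cvgD; [apply: cvgMr; exact: cvg_id|exact: cvg_cst].
Qed.

Lemma continuous_zigzag : continuous zigzag.
Proof.
have -> : zigzag = ((fun t => 3 * t + 0) \min (fun t => - 3 * t + 2)) \max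
    (fun t => 3 * t + - 2).
  by apply/funext => t; rewrite /zigzag /= addr0 mulNr [2 - _]addrC.
apply: max_fun_continuous; last exact: continuous_affine.
by apply: min_fun_continuous; exact: continuous_affine.
Qed.

Lemma continuous_threshold : continuous threshold.
Proof.
have -> : threshold = (fun=> 1) \min ((fun=> 0) \max (fun t => 3 * t + - 1)).
  by [].
apply: min_fun_continuous; first by move=> t; exact: cvg_cst.
apply: max_fun_continuous; last exact: continuous_affine.
by move=> t; exact: cvg_cst.
Qed.

Lemma continuous_iter_zigzag n : continuous (iter n zigzag).
Proof.
elim: n => [|n IHn] t; first exact: cvg_id.
apply: (@continuous_comp _ _ _ (iter n zigzag) zigzag); first exact: IHn.
exact: continuous_zigzag.
Qed.

Lemma continuous_schoenberg : continuous schoenberg.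
Proof.
have [h0 h1] := half_bounds.
apply: (continuous_expansion h0 h1 (a := fun k t => threshold (iter k.*2 zigzag t))).
  by move=> k t; exact: threshold_bound.
move=> k t; apply: (@continuous_comp _ _ _ (iter k.*2 zigzag) threshold).
  exact: continuous_iter_zigzag.
exact: continuous_threshold.
Qed.

Lemma schoenberg_bound t : 0 <= schoenberg t <= 1.
Proof.
have [h0 h1] := half_bounds.
by apply: expansion_bound => // k; exact: threshold_bound.
Qed.

(** The point of the Cantor set with ternary digits [2 * c k]. *)
Definition cantor_point c : R := expansion 3^-1 (fun k => (c k)%:R).

Lemma digit_bound (b : bool) : 0 <= (b%:R : R) <= 1.
Proof. by case: b; rewrite /= ler01 !lexx. Qed.

Lemma cantor_point_bound c : 0 <= cantor_point c <= 1.
Proof.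
have [h0 h1] := third_bounds.
by apply: expansion_bound => // k; exact: digit_bound.
Qed.

Lemma cantor_pointS c :
  3 * cantor_point c = 2 * (c 0)%:R + cantor_point (fun k => c k.+1).
Proof.
have [h0 h1] := third_bounds.
rewrite /cantor_point expansionS //; last by move=> k; exact: digit_bound.
by field.
Qed.

(** A leading digit 0 places the point in [0, 1/3], where [zigzag] is [3 * t]; a leading digit 2
    places it in [2/3, 1], where it is [3 * t - 2]. *)
Lemma zigzag_cantor_point c : zigzag (cantor_point c) = cantor_point (fun k => c k.+1).
Proof.
rewrite /zigzag cantor_pointS; have := cantor_point_bound (fun k => c k.+1).
by case: (c 0%N) => /=; set s := cantor_point _ => /andP[s0 s1];
  rewrite /Order.max /Order.min; do 2 case: ifP; lra.
Qed.

Lemma iter_zigzag_cantor_point c n :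
  iter n zigzag (cantor_point c) = cantor_point (fun k => c (n + k)%N).
Proof.
elim: n c => [//|n IHn] c.
by rewrite iterSr zigzag_cantor_point IHn.
Qed.

(** [threshold] is 0 on [0, 1/3] and 1 on [2/3, 1]; its slope in between is never met. *)
Lemma threshold_cantor_point c : threshold (cantor_point c) = (c 0)%:R.
Proof.
rewrite /threshold cantor_pointS; have := cantor_point_bound (fun k => c k.+1).
by case: (c 0%N) => /=; set s := cantor_point _ => /andP[s0 s1];
  rewrite /Order.max /Order.min; do 2 case: ifP; lra.
Qed.

Lemma schoenberg_cantor_point c :
  schoenberg (cantor_point c) = expansion 2^-1 (fun k => (c k.*2)%:R).
Proof.
congr expansion; apply/funext => k.
by rewrite iter_zigzag_cantor_point threshold_cantor_point addn0.
Qed.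

(** On [0, 1], doubling modulo 1, except that 1 is fixed and so gets the digits 111... *)
Definition doubling u : R := if 2^-1 <= u then 2 * u - 1 else 2 * u.

Definition binary_digit u n : bool := 2^-1 <= iter n doubling u.

(** The orbit of [u] under [doubling] stays in [0, 1] and obeys the recursion of
    [expansion_unique]. *)
Lemma binary_expansion u : 0 <= u <= 1 ->
  u = expansion 2^-1 (fun k => (binary_digit u k)%:R).
Proof.
have [h0 h1] := half_bounds => u01.
have x01 k : 0 <= iter k doubling u <= 1.
  elim: k => //= k; set x := iter _ _ _ => /andP[x0 x1].
  by rewrite /doubling; case: ifP => hx; apply/andP; split; lra.
apply: (expansion_unique h0 h1 (x := fun k => iter k doubling u)) => // k.
  exact: digit_bound.
by rewrite /binary_digit iterS /doubling; case: ifP => hx /=; field.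
Qed.

Lemma schoenberg_surjective u v : 0 <= u <= 1 -> 0 <= v <= 1 ->
  exists t, [/\ 0 <= t <= 1, schoenberg t = u & schoenberg (zigzag t) = v].
Proof.
move=> /binary_expansion uE /binary_expansion vE.
(* Even places carry the digits of [u], odd places those of [v]. *)
pose c n := binary_digit (if odd n then v else u) n./2.
exists (cantor_point c); split; first exact: cantor_point_bound.
- rewrite schoenberg_cantor_point [RHS]uE; congr expansion; apply/funext => k.
  by rewrite /c odd_double doubleK.
(* The shift by [zigzag] moves the odd places to even ones. *)
- rewrite zigzag_cantor_point schoenberg_cantor_point [RHS]vE.
  congr expansion; apply/funext => k.
  by rewrite /c /= odd_double uphalf_double.
Qed.

End schoenberg.

(** * The curves with powers of Schoenberg's function as coordinates *)

Section power_curves.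
Context {R : realType}.

Lemma I01P (x : R) : 0 <= x <= 1 -> I01 R x.
Proof. by rewrite /I01 /= in_itv. Qed.

Lemma val_I01_bound (t : I01 R) : 0 <= set_val t <= 1.
Proof. by have := set_valP t; rewrite /I01 /= in_itv. Qed.

Lemma expr_bound (x : R) n : 0 <= x <= 1 -> I01 R (x ^+ n).
Proof. by case/andP=> x0 x1; apply: I01P; rewrite exprn_ge0 //= exprn_ile1. Qed.

Definition power_curve_fun i j (t : I01 R) : I01 R * I01 R :=
  (SigSub (mem_set (expr_bound i (schoenberg_bound (set_val t)))),
   SigSub (mem_set (expr_bound j (schoenberg_bound (zigzag (set_val t)))))).

Lemma continuous_power_curve i j : continuous (power_curve_fun i j).
Proof.
have cval : continuous (set_val : I01 R -> R) by exact: initial_continuous.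
have cX n (g : R -> R) : continuous g -> continuous (fun t : I01 R => g (set_val t) ^+ n).
  move=> cg t; apply: (@continuous_comp _ _ _ (g \o set_val) (fun x => x ^+ n)).
    by apply: continuous_comp; [exact: cval|exact: cg].
  exact: exprn_continuous.
have c1 : continuous (fun t => (power_curve_fun i j t).1).
  by apply: continuous_comp_initial; exact: (cX i _ continuous_schoenberg).
have c2 : continuous (fun t => (power_curve_fun i j t).2).
  apply: continuous_comp_initial; apply: (cX j (schoenberg \o zigzag)) => s.
  by apply: continuous_comp; [exact: continuous_zigzag|exact: continuous_schoenberg].
by move=> t; exact: (cvg_pair (c1 t) (c2 t)).
Qed.

Definition power_curve i j : curve R := mkcts (@continuous_power_curve i j).

Lemma power_curveM i j k l :
  (power_curve i j * power_curve k l)%g = power_curve (i + k) (j + l).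
Proof.
apply/continuousEP => t; rewrite [LHS]curve_mulE.
by congr pair; apply/val_inj; rewrite /= exprD.
Qed.

(** Makes positive powers map [0, 1] onto itself; the successor excludes the constant power 0. *)
Lemma rootn_exists (x : R) n : 0 <= x <= 1 ->
  exists2 y, 0 <= y <= 1 & y ^+ n.+1 = x.
Proof.
move=> /andP[x0 x1].
have yX : (x `^ n.+1%:R^-1) ^+ n.+1 = x.
  by rewrite -powR_mulrn ?powR_ge0 // -powRrM mulVf ?pnatr_eq0 // powRr1.
exists (x `^ n.+1%:R^-1) => //; rewrite powR_ge0 /=.
by rewrite -(@expr_le1 _ n.+1) ?powR_ge0 // yX.
Qed.

Lemma power_curve_surjective i j : surjective_curves R (power_curve i.+1 j.+1).
Proof.
apply/seteqP; split=> // -[u v] _.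
have [x x01 xE] := rootn_exists i (val_I01_bound u).
have [y y01 yE] := rootn_exists j (val_I01_bound v).
have [t [t01 tx ty]] := schoenberg_surjective x01 y01.
exists (SigSub (mem_set (I01P t01))) => //.
by congr pair; apply/val_inj; rewrite /= ?tx ?ty.
Qed.

(** At a parameter where both base coordinates equal 1/2, the value determines the exponents, as the
    powers of 1/2 are distinct. *)
Lemma power_curve_inj i j k l : power_curve i j = power_curve k l -> i = k /\ j = l.
Proof.
have h01 : 0 <= (2^-1 : R) <= 1 by apply/andP; split; lra.
have [t [t01 tx ty]] := schoenberg_surjective h01 h01.
have inj2 : injective (GRing.exp (2^-1 : R)) by apply: ieexprIn; lra.
move=> /(congr1 (fun f : curve R => f (SigSub (mem_set (I01P t01))))) E.
split; apply: inj2.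
- by have /(congr1 val) := congr1 fst E; rewrite /= tx.
- by have /(congr1 val) := congr1 snd E; rewrite /= ty.
Qed.

End power_curves.

Theorem theorem3p4 (R : realType) : semigroupable (surjective_curves R).
Proof.
pose G := [set f : curve R | exists i j, f = power_curve i.+1 j.+1].
have GM : mulg_closed (mem G).
  apply/mulg_closed_memP => _ _ [i [j ->]] [k [l ->]]; exists (i + k).+1, (j + l).+1.
  by rewrite power_curveM !addSn !addnS.
exists G; split.
- by move=> _ [i [j ->]]; exact: power_curve_surjective.
- exact: GM.
- apply: (@infinitely_generated_irreducible _ G (fun n => power_curve 1 n.+1)) => //.
  + by move=> m n /power_curve_inj[_ []].
  + by move=> n; exists 0, n.
  (* A product of two members of [G] has first exponent at least 2, never 1. *)
  + move=> n _ _ [i [j ->]] [k [l ->]]; rewrite power_curveM => /power_curve_inj[].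
    by rewrite addnS.
Qed.
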